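(* Let $(S,\rho)$ be a separable compact metric space with a Borel measure $\nu$, and let $\lambda:S\to[0,\infty)$ be $\nu$-integrable and continuous, such that for all $\zeta\in S$ there exists $\lambda_0>0$ with $\lambda(\zeta)\ge\lambda_0$. Let $k:\mathbb{R}\to[0,\infty)$ be symmetric (that is, $k(-t)=k(t)$), with $k(t)=0$ for $|t|>\mathrm{diam}(S)$, with $k$ continuous on $[0,\mathrm{diam}(S)]$, and such that for some $k_0>0$ one has $k(t)>k_0$ for all $t\in[0,\mathrm{diam}(S)]$. Let $X_1,X_2,\dots$ be independent Poisson processes on $S$, each with intensity $\lambda$. Then for $\nu$-almost every $\zeta\in S$ there exists a (deterministic) sequence of positive numbers $\sigma_m=\sigma_m(\zeta)\to0$ such that the estimator $\hat{\hat\lambda}_m(\zeta)$ built from $X_1,\dots,X_m$ with smoothing parameter $\sigma_m(\zeta)$ satisfies $$\lim_{m\to\infty}\big|\hat{\hat\lambda}_m(\zeta)-\lambda(\zeta)\big|=0\quad\text{almost surely.}$$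
   Context: Let $S^\infty=\{x\subset S:\#x<\infty\}$ be the set of finite subsets of $S$. Given a probability space $(\Omega,\mathcal A,\mathbb P)$, a map $X:\Omega\to S^\infty$ is a Poisson process on $S$ with intensity $\lambda$ if: for every Borel set $A\subset S$, $N_A(\omega)=\#(X(\omega)\cap A)$ is a random variable; for disjoint Borel sets $A_1,\dots,A_n$ the variables $N_{A_1},\dots,N_{A_n}$ are independent; and $N_A$ has the Poisson distribution with mean $\mu(A)=\int_A\lambda\,d\nu$. $\mathrm{diam}(S)=\sup_{x,y\in S}\rho(x,y)$. Estimator: fix a constant $d>0$ (its value is irrelevant since the factor $\sigma^{-d}$ cancels). For $\sigma>0$ and $\zeta\in S$ let $$K_\sigma(\zeta)=\int_S\frac1{\sigma^d}k\Big(\frac{\rho(\zeta,\xi)}{\sigma}\Big)d\nu(\xi).$$ For the realization of the process $X_j$ (a finite subset of $S$) let $$\hat\lambda_j(\zeta)=\frac1{K_\sigma(\zeta)}\sum_{\xi\in X_j}\frac1{\sigma^d}k\Big(\frac{\rho(\zeta,\xi)}{\sigma}\Big),$$ and $$\hat{\hat\lambda}_m(\zeta)=\frac1m\sum_{j=1}^m\hat\lambda_j(\zeta).$$ *)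

(* Defs.v *)
From HB Require Import structures.
From mathcomp Require Import all_boot all_order all_algebra finmap.
From mathcomp Require Import all_classical all_reals all_analysis.

Set Implicit Arguments.
Unset Strict Implicit.
Unset Printing Implicit Defensive.

Import Order.TTheory GRing.Theory Num.Theory.
Import numFieldNormedType.Exports.

Local Open Scope classical_set_scope.
Local Open Scope ring_scope.

(* The two structures are unrelated here: that the measurable sets are the
   Borel sets is the separate predicate [borel_measurable]. Measurable types
   are pointed in the library, so that the space is nonempty. *)
#[short(type="measurableMetricType")]
HB.structure Definition MeasurableMetric (disp : measure_display)
    (K : numDomainType) :=
  { S of Metric K S & Measurable disp S }.

Section Space.
Context {R : realType} {disp : measure_display}.

Definition borel_measurable (S : measurableMetricType disp R) : Prop :=
  @measurable disp S = <<s [set U : set S | open U] >>.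

Definition separable (S : measurableMetricType disp R) : Prop :=
  exists D : set S, countable D /\ dense D.

Definition diam (S : measurableMetricType disp R) : R :=
  sup [set mdist p.1 p.2 | p in [set: S * S]].

End Space.

Section Independence.
Context {R : realType} {dT : measure_display} {T : measurableType dT}.

(* Mutual independence of a family of classes of events. *)
Definition independent_classes (P : probability T R) (I : choiceType)
    (F : I -> set (set T)) : Prop :=
  forall (J : {fset I}) (E : I -> set T),
    (forall i, i \in J -> F i (E i)) ->
    P (\bigcap_(i in [set` J]) E i) = (\prod_(i <- J) P (E i))%E.

Definition sigma_of {dU : measure_display} {U : measurableType dU}
    (Y : T -> U) : set (set T) :=
  preimage_set_system setT Y measurable.

End Independence.

Section PoissonProcess.
Context {R : realType} {disp : measure_display}.
Context {S : measurableMetricType disp R}.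
Context {dT : measure_display} {T : measurableType dT}.

Definition count_in (X : T -> {fset S}) (A : set S) (w : T) : nat :=
  #|` [fset xi in X w | xi \in A]%fset |.

(* [poisson_prob r n] does not depend on [n], and is the Dirac mass at 0 when
   r = 0. The real-valued integral is the intended mean as soon as lambda is
   nu-integrable. *)
Definition poisson_process (P : probability T R)
    (nu : {measure set S -> \bar R}) (lambda : S -> R)
    (X : T -> {fset S}) : Prop :=
  [/\ forall A : set S, measurable A -> measurable_fun setT (count_in X A),
      forall (n : nat) (A : 'I_n -> set S),
        (forall i, measurable (A i)) -> trivIset setT A ->
        independent_classes P (fun i => sigma_of (count_in X (A i)))
    & forall A : set S, measurable A -> forall B : set nat,
        P (count_in X A @^-1` B) =
        poisson_prob (\int[nu]_(xi in A) lambda xi) 0 B].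

(* The sigma-algebra generated by a process, the space of finite subsets of S
   carrying the coarsest sigma-algebra for which all counts are measurable. *)
Definition sigma_process (X : T -> {fset S}) : set (set T) :=
  <<s \bigcup_(A in @measurable disp S) sigma_of (count_in X A) >>.

End PoissonProcess.

Section Estimator.
Context {R : realType} {disp : measure_display}.
Context {S : measurableMetricType disp R}.
Variables (nu : {measure set S -> \bar R}) (k : R -> R) (d : R).

Definition scaled_kernel (sigma : R) (zeta xi : S) : R :=
  (sigma `^ d)^-1 * k (mdist zeta xi / sigma).

Definition kernel_mass (sigma : R) (zeta : S) : R :=
  \int[nu]_xi scaled_kernel sigma zeta xi.

Definition lambda_hat (sigma : R) (x : {fset S}) (zeta : S) : R :=
  (kernel_mass sigma zeta)^-1 * \sum_(xi <- x) scaled_kernel sigma zeta xi.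

(* The realizations are indexed from 0: [x 0, ..., x (m - 1)] are used. *)
Definition lambda_hathat (sigma : R) (x : nat -> {fset S}) (m : nat)
    (zeta : S) : R :=
  m%:R^-1 * \sum_(j < m) lambda_hat sigma (x j) zeta.

End Estimator.

(* Main.v *)
(* Dividing the kernel by its mass turns the estimator at [zeta] into an
   empirical mean over the processes of sums [\sum_(xi in X j) h xi], where [h]
   is a probability density w.r.t. [nu] supported in a ball around [zeta] of
   radius [sigma * diam S]; this makes sense for every [zeta] in the support of
   [nu], hence almost everywhere since [S] is separable. For fixed [sigma] the
   empirical mean tends almost surely to [\int h lambda d nu]: approximating [h]
   uniformly by a combination of indicators reduces this to the strong law for
   the counts [N_A], which are independent Poisson variables, and there
   exponential moments give summable tails. By continuity of [lambda] the limit
   tends to [lambda zeta] as [sigma] tends to 0. Finally Egorov's theorem and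
   the Borel-Cantelli lemma provide a deterministic diagonal sequence along
   which [sigma] decreases slowly enough. *)
Require Import Defs.
From mathcomp Require Import all_boot all_order all_algebra finmap.
From mathcomp Require Import all_classical all_reals all_analysis.
From mathcomp Require Import measurable_realfun.
From mathcomp Require Import ring lra.

Set Implicit Arguments.
Unset Strict Implicit.
Unset Printing Implicit Defensive.

Import Order.TTheory GRing.Theory Num.Theory.
Import numFieldNormedType.Exports.

Local Open Scope classical_set_scope.
Local Open Scope ring_scope.

(** * Expectation of a product of functions of independent counts *)

Section IndependentProducts.
Context {R : realType} {dT : measure_display} {T : measurableType dT}.
Variables (P : probability T R) (Y : nat -> T -> nat).
Hypothesis mY : forall j, measurable_fun setT (Y j).
Hypothesis indepY : independent_classes P (fun j => sigma_of (Y j)).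

Let sigma_of_preimage j B : sigma_of (Y j) (Y j @^-1` B).
Proof. by exists B => //; rewrite setTI. Qed.

Let measurable_sigma_of j E : sigma_of (Y j) E -> measurable E.
Proof. by move=> [B mB <-]; exact: mY. Qed.

Let measurable_prod_Y (f : nat -> R) m :
  measurable_fun setT (fun w => \prod_(j < m) f (Y j w)).
Proof.
apply: measurable_prod => j _.
by apply: (@measurableT_comp _ _ _ _ _ _ f) => //; exact: mY.
Qed.

(* The statement is strengthened by an event of the future so that the
   induction on [m] closes. *)
Lemma integral_prod_indep_restrict (f : nat -> R) (c : R) :
  (forall n, 0 <= f n) ->
  (forall j, (\sum_(n <oo) (f n)%:E * P (Y j @^-1` [set n]) = c%:E)%E) ->
  forall (m : nat) (J : {fset nat}) (E : nat -> set T),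
    (forall i, i \in J -> (m <= i)%N) ->
    (forall i, i \in J -> sigma_of (Y i) (E i)) ->
    (\int[P]_(w in \bigcap_(i in [set` J]) E i) (\prod_(j < m) f (Y j w))%:E
     = (c ^+ m)%:E * P (\bigcap_(i in [set` J]) E i))%E.
Proof.
move=> f0 fc; elim=> [|m IHm] J E Jm JE.
  under eq_integral do rewrite big_ord0.
  rewrite integral_cst ?expr0//.
  by apply: fin_bigcap_measurable => // i iJ; exact: measurable_sigma_of (JE i iJ).
set D := \bigcap_(i in _) _.
have mD : measurable D.
  by apply: fin_bigcap_measurable => // i iJ; exact: measurable_sigma_of (JE i iJ).
(* The event that [Y m] equals [n] joins the family at index [m]: once [D] is cut along the values
   of [Y m], the factor [f (Y m w)] is constant on each piece and the induction hypothesis applies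
   with [m] added to [J]. *)
pose E' n i := if i == m then Y m @^-1` [set n] else E i.
have mJ : m \notin J by apply/negP => /Jm; rewrite ltnn.
have E'J n i : i \in J -> E' n i = E i.
  by move=> iJ; rewrite /E'; case: eqP iJ mJ => // -> ->.
have E'm n : E' n m = Y m @^-1` [set n] by rewrite /E' eqxx.
have E'D n : \bigcap_(i in [set` (m |` J)%fset]) E' n i =
             D `&` Y m @^-1` [set n].
  rewrite bigcap_fsetU1 setIC E'm; congr (_ `&` _).
  by apply: eq_bigcapr => i iJ; rewrite E'J.
have E'sigma n i : i \in (m |` J)%fset -> sigma_of (Y i) (E' n i).
  rewrite in_fset1U; have [->|im /= iJ] := eqVneq i m.
    by rewrite E'm.
  by rewrite E'J//; exact: JE.
have PD n : P (D `&` Y m @^-1` [set n]) = (P D * P (Y m @^-1` [set n]))%E.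
  rewrite -E'D indepY; last exact: E'sigma.
  rewrite big_fsetU1//= muleC E'm indepY//; congr (_ * _)%E.
  by apply: eq_big_seq => i iJ; rewrite E'J.
have mF n : measurable (D `&` Y m @^-1` [set n]).
  by apply: measurableI => //; rewrite -[X in measurable X]setTI; exact: mY.
have -> : D = \bigcup_n (D `&` Y m @^-1` [set n]).
  by rewrite -setI_bigcupr; apply/seteqP; split=> [w Dw|w []//]; split=> //; exists (Y m w).
rewrite ge0_integral_bigcup//; last 3 first.
- apply/measurable_EFinP; apply: measurable_funTS; exact: measurable_prod_Y.
- by move=> w _; rewrite lee_fin prodr_ge0.
- apply/trivIsetP => i j _ _ ij; rewrite -subset0 => w /= [[_ Yi] [_ Yj]].
  by move: ij; rewrite -Yi -Yj eqxx.
rewrite -setI_bigcupr (_ : \bigcup_i _ = setT) ?setIT; last first.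
  by apply/seteqP; split => // w _; exists (Y m w).
transitivity (\sum_(n <oo)
    ((c ^+ m)%:E * P D) * ((f n)%:E * P (Y m @^-1` [set n])))%E.
  apply: eq_eseriesr => n _.
  transitivity (\int[P]_(w in D `&` Y m @^-1` [set n])
      ((f n)%:E * (\prod_(j < m) f (Y j w))%:E))%E.
    apply: eq_integral => w; rewrite inE => -[_ /= Ymn].
    by rewrite big_ord_recr/= Ymn -EFinM mulrC.
  rewrite ge0_integralZl_EFin//; last 2 first.
  - by move=> w _; rewrite lee_fin prodr_ge0.
  - apply/measurable_EFinP; apply: measurable_funTS; exact: measurable_prod_Y.
  rewrite -E'D IHm//; last 2 first.
  - by move=> i; rewrite in_fset1U => /orP[/eqP -> //|/Jm /ltnW].
  - exact: E'sigma.
  by rewrite E'D PD -[RHS]muleA [LHS]muleCA; congr *%E; exact: muleCA.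
have /fineK <- : ((c ^+ m)%:E * P D)%E \is a fin_num.
  by rewrite fin_numM// fin_num_measure.
rewrite nneseriesZl ?fc; last first.
  by move=> n _; apply: mule_ge0; rewrite ?lee_fin.
rewrite fineK; last by rewrite fin_numM// fin_num_measure.
by rewrite exprSr EFinM muleAC.
Qed.

Lemma integral_prod_indep (f : nat -> R) (c : R) (m : nat) :
  (forall n, 0 <= f n) ->
  (forall j, (\sum_(n <oo) (f n)%:E * P (Y j @^-1` [set n]) = c%:E)%E) ->
  (\int[P]_w (\prod_(j < m) f (Y j w))%:E = (c ^+ m)%:E)%E.
Proof.
move=> f0 fc; have := @integral_prod_indep_restrict f c f0 fc m fset0 (fun=> setT).
by rewrite set_fset0 bigcap_set0 probability_setT mule1; apply.
Qed.

End IndependentProducts.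

(** * The Poisson moment generating function and a bound on [expR] *)

Section PoissonLaw.
Context {R : realType}.

(** For positive [r], factoring out exp(-r) leaves the exponential series at [r * expR t]; for
    [r = 0] only the term [n = 0] survives. *)
Lemma poisson_prob_mgf (r t : R) : 0 <= r ->
  (\sum_(n <oo) (expR (t * n%:R))%:E * poisson_prob r 0 [set n]
   = (expR (r * (expR t - 1)))%:E)%E.
Proof.
rewrite le_eqVlt => /predU1P[<-|r0].
  rewrite mul0r expR0 /poisson_prob ltxx nneseries_recl//; last first.
    by move=> n _; apply: mule_ge0; rewrite // lee_fin expR_ge0.
  rewrite mulr0 expR0 diracE mem_set// mul1e eseries0 ?adde0// => n n0 _.
  by rewrite diracE memNset ?mule0//= => /esym n0'; rewrite n0' in n0.
have termE n : ((expR (t * n%:R))%:E * poisson_prob r 0 [set n]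
    = (expR (- r))%:E * (exp_coeff (r * expR t) n)%:E)%E.
  rewrite /poisson_prob r0 esum_set1 ?lee_fin ?poisson_pmf_ge0//.
  rewrite /poisson_pmf r0 -!EFinM /exp_coeff/= exprMn -expRM_natl mulr_natl.
  by rewrite mulr_natr; congr (_%:E); ring.
under eq_eseriesr do rewrite termE.
have rt0 : 0 <= r * expR t by rewrite mulr_ge0 ?expR_ge0 ?ltW.
rewrite nneseriesZl; last by move=> n _; rewrite lee_fin exp_coeff_ge0.
rewrite (_ : \sum_(n <oo) _ = (expR (r * expR t))%:E)%E.
  by rewrite -EFinM -expRD; congr (expR _)%:E; ring.
rewrite /expR -EFin_lim; last exact: is_cvg_series_exp_coeff.
by apply/congr_lim/funext => n/=; rewrite /series/= -sumEFin.
Qed.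

(** Inverting exp(-t) >= 1 - t gives exp(t) <= 1/(1 - t), and (1 + t + 2t^2)(1 - t) = 1 + t^2(1 -
    2t) >= 1. *)
Lemma expR_le_quadratic (t : R) : `|t| <= 2^-1 -> expR t <= 1 + t + 2 * t ^+ 2.
Proof.
move=> th; have /andP[tl tu] : - 2^-1 <= t <= 2^-1 by rewrite -ler_norml.
have t1 : 0 < 1 - t by lra.
have : (expR t)^-1 >= 1 - t by rewrite -expRN; exact: expR_ge1Dx.
rewrite -lef_pV2 ?posrE ?invr_gt0 ?expR_gt0// invrK => /le_trans; apply.
rewrite -div1r ler_pdivrMr//.
have : 0 <= t ^+ 2 * (1 - 2 * t) by rewrite mulr_ge0 ?sqr_ge0//; lra.
by move=> ?; nra.
Qed.

End PoissonLaw.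

(** * Strong law of large numbers for independent Poisson counts *)

Section PoissonStrongLaw.
Context {R : realType} {dT : measure_display} {T : measurableType dT}.
Variables (P : probability T R) (Y : nat -> T -> nat) (r : R).
Hypothesis r_ge0 : 0 <= r.
Hypothesis mY : forall j, measurable_fun setT (Y j).
Hypothesis indepY : independent_classes P (fun j => sigma_of (Y j)).
Hypothesis poissonY :
  forall j (B : set nat), P (Y j @^-1` B) = poisson_prob r 0 B.

(* The exponential moments [exp (t (S_m - m r) - m a)] are summable in [m], so
   almost surely they tend to 0. *)
Lemma poisson_sum_tail (t a : R) : r * (expR t - 1 - t) < a ->
  {ae P, forall w, \forall m \near \oo,
    t * (\sum_(j < m) (Y j w)%:R - m%:R * r) <= a * m%:R}.
Proof.
move=> ra; pose f n := expR (t * n%:R - (t * r + a)).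
(* [q] is the expectation of [f (Y j)]; its exponent r(e^t - 1 - t) - a is negative, so the expected
   products form a convergent geometric series. *)
pose q := expR (r * (expR t - 1) - (t * r + a)).
have q0 : 0 <= q := expR_ge0 _.
have q1 : `|q| < 1 by rewrite ger0_norm// expR_lt1; lra.
have f0 n : 0 <= f n := expR_ge0 _.
have mf m : measurable_fun setT (fun w => (\prod_(j < m) f (Y j w))%:E).
  apply/measurable_EFinP/measurable_prod => j _.
  by apply: (@measurableT_comp _ _ _ _ _ _ f) => //; exact: mY.
have prod_ge0 m w : (0 <= (\prod_(j < m) f (Y j w))%:E)%E.
  by rewrite lee_fin prodr_ge0.
have int_prod m : (\int[P]_w (\prod_(j < m) f (Y j w))%:E = (q ^+ m)%:E)%E.
  apply: integral_prod_indep => // j.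
  under eq_eseriesr do rewrite poissonY /f expRD mulrC EFinM -muleA.
  rewrite nneseriesZl; last by move=> n _; apply: mule_ge0; rewrite // lee_fin expR_ge0.
  by rewrite poisson_prob_mgf// -EFinM -expRD addrC.
have int_series :
    (\int[P]_w (\sum_(m <oo) (\prod_(j < m) f (Y j w))%:E) < +oo)%E.
  rewrite integral_nneseries//.
  under eq_eseriesr do rewrite int_prod.
  have /cvg_lim : (EFin \o series (geometric 1 q)) @ \oo --> (1 / (1 - q))%:E.
    by apply: cvg_EFin; [exact: nearW|exact: cvg_geometric_series].
  rewrite (_ : EFin \o _ = fun n => \sum_(0 <= i < n) (q ^+ i)%:E)%E.
    by move=> ->//; rewrite ltry.
  apply/funext => n/=; rewrite /series/= -sumEFin.
  by apply: eq_bigr => i _; rewrite /geometric/= mul1r.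
have : P.-integrable setT (fun w => \sum_(m <oo) (\prod_(j < m) f (Y j w))%:E)%E.
  apply/integrableP; split.
    by apply: ge0_emeasurable_sum => // m w _ _; exact: prod_ge0.
  by under eq_integral do rewrite gee0_abs ?nneseries_ge0//.
move/(integrable_ae measurableT); apply: filterS => w /(_ I).
rewrite ge0_fin_numE ?nneseries_ge0// => /nneseries_tail_cvg.
move=> /(_ (fun k _ => prod_ge0 k w)) tail0.
have : \forall m \near \oo, (\sum_(m <= k <oo) (\prod_(j < k) f (Y j w))%:E < 1)%E.
  have : nbhs (0%E : \bar R) [set x | (x < 1)%E].
    by apply: open_nbhs_nbhs; split; [exact: open_ereal_lt_ereal|exact: lte01].
  by move/tail0.
apply: filterS => m tail1.
(* Term [m] is at most the tail that starts with it; a value below 1 means a negative exponent,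
   which is the claim. *)
have : ((\prod_(j < m) f (Y j w))%:E < 1)%E.
  apply: le_lt_trans tail1.
  have := @nneseries_lim_ge R (fun k => (\prod_(j < k) f (Y j w))%:E) xpredT m m.+1.
  by rewrite big_nat1; apply.
rewrite lte_fin -expR_sum expR_lt1 big_split/= -mulr_sumr.
rewrite sumr_const card_ord -mulr_natl => ?; nra.
Qed.

(** The tail bounds at [t = d n] and [t = - d n] confine the centred sum to [e n * m] in absolute
    value; the tolerances are countably many, so one null set serves them all. *)
Lemma poisson_strong_law :
  {ae P, forall w,
    (fun m => m%:R^-1 * \sum_(j < m) (Y j w)%:R : R) @ \oo --> r}.
Proof.
pose e n : R := n.+1%:R^-1.
(* For |t| = d the quadratic bound gives r(e^t - 1 - t) <= 2 r d^2, and [d n * r <= e n / 4] puts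
   this below [d n * e n]. Dividing by [r + 1] covers [r = 0] as well. *)
pose d n : R := e n / (4 * (r + 1)).
have e0 n : 0 < e n by rewrite invr_gt0.
have e1 n : e n <= 1 by rewrite invf_le1// ler1n.
have r1 : 0 < r + 1 by rewrite ltr_wpDl.
have d0 n : 0 < d n by rewrite divr_gt0// mulr_gt0.
have dr n : d n * r + d n = e n / 4 by rewrite /d; field; rewrite gt_eqF.
have dr0 n : 0 <= d n * r by rewrite mulr_ge0// ltW.
have d1 n : d n <= 2^-1 by have := e1 n; have := dr n; have := dr0 n; lra.
have da n t : `|t| = d n -> r * (expR t - 1 - t) < d n * e n.
  move=> td; have tt : t ^+ 2 = d n ^+ 2 by rewrite -td real_normK ?num_real.
  have := @expR_le_quadratic _ t; rewrite td tt => /(_ (d1 n)) h.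
  apply: (@le_lt_trans _ _ (r * (2 * d n ^+ 2))).
    by rewrite ler_wpM2l//; lra.
  by have := d0 n; have := dr n; have := e0 n; nra.
have : {ae P, forall w, forall n, \forall m \near \oo,
    `|\sum_(j < m) (Y j w)%:R - m%:R * r| <= e n * m%:R}.
  apply: ae_foralln => n.
  have := @poisson_sum_tail (d n) (d n * e n).
  have := @poisson_sum_tail (- d n) (d n * e n).
  move=> /(_ (da _ _ _)) hN /(_ (da _ _ _)) hP.
  have {}hN := hN ltac:(by rewrite normrN gtr0_norm).
  have {}hP := hP ltac:(by rewrite gtr0_norm).
  apply: filterS2 hN hP => w hN hP; apply: filterS2 hN hP => m hN hP.
  by rewrite ler_norml; apply/andP; split; rewrite -(ler_pM2l (d0 n)); nra.
apply: filterS => w wP; apply/cvgrPdist_le => /= eps eps0.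
have [n _ ne] : \forall n \near \oo, e n < eps := near_infty_natSinv_lt (PosNum eps0).
have {}ne := ne n (leqnn n).
near=> m.
have m0 : 0 < m%:R :> R by rewrite ltr0n; near: m; exact: nbhs_infty_gt.
rewrite (_ : r - _ = - (m%:R^-1 * (\sum_(j < m) (Y j w)%:R - m%:R * r))); last first.
  by field; rewrite gt_eqF.
rewrite normrN normrM gtr0_norm ?invr_gt0// mulrC ler_pdivrMr//.
apply: (@le_trans _ _ (e n * m%:R)); last by rewrite ler_wpM2r ?ltW.
by near: m; exact: wP.
Unshelve. all: by end_near. Qed.

End PoissonStrongLaw.

(** * Egorov, Borel-Cantelli and the diagonal choice *)

Section DiagonalSequence.
Context {R : realType} {dT : measure_display} {T : measurableType dT}.
Variable P : probability T R.

Lemma egorov_eventually (Z : nat -> T -> R) (c e eta : R) :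
  (forall m, measurable_fun setT (Z m)) ->
  {ae P, forall w, Z ^~ w @ \oo --> c} -> 0 < e -> 0 < eta ->
  exists B : set T, [/\ measurable B, (P B < eta%:E)%E &
    exists M, forall m w, (M <= m)%N -> ~ B w -> `|Z m w - c| < e].
Proof.
move=> mZ Zc e0 eta0.
have PT : (P setT < +oo)%E by rewrite probability_setT ltry.
have Zc' : {ae P, forall w, setT w -> Z ^~ w @ \oo --> (cst c : T -> R) w}.
  by apply: filterS Zc => w + _.
have mc : measurable_fun setT (cst c : T -> R) by exact: measurable_cst.
have [B [mB PB ZB]] := ae_pointwise_almost_uniform mZ mc measurableT PT Zc' eta0.
exists B; split => //.
have : nbhs (cst c : {uniform` setT `\` B -> R})
    [set h | forall w, (setT `\` B) w -> ball c e (h w)].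
  apply/uniform_nbhs; exists [set xy | ball xy.1 e xy.2]; split => //.
  exact: entourage_ball (PosNum e0).
move=> /ZB [M _ MP]; exists M => m w Mm Bw.
by have := MP m Mm w (conj I Bw); rewrite /ball/= distrC.
Qed.

(** By Egorov, row [n] is within 1/(n+1) of [c n] from [M n] on, outside a set [B n] of measure
    below 2^-(n+1). Almost every [w] lies in finitely many [B n], so entering row [n] only after
    time [M n] keeps the diagonal close to [c]. *)
Lemma diagonal_ae_cvg (Z : nat -> nat -> T -> R) (c : nat -> R) (l : R) :
  (forall n m, measurable_fun setT (Z n m)) ->
  (forall n, {ae P, forall w, Z n ^~ w @ \oo --> c n}) ->
  c @ \oo --> l ->
  exists phi : nat -> nat, phi @ \oo --> \oo /\
    {ae P, forall w, (fun m => Z (phi m) m w) @ \oo --> l}.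
Proof.
move=> mZ Zc cl.
have /choice[B /all_and3[mB PB /choice[M BM]]] n := @egorov_eventually (Z n) (c n)
  n.+1%:R^-1 (1 / (2 ^ n.+1)%:R) (mZ n) (Zc n) ltac:(by []) ltac:(by []).
(* The largest row up to [m] whose threshold is passed at time [m]; the cap at [m] keeps the range
   finite. *)
pose phi m := \max_(n < m.+1 | (M n <= m)%N) n.
have phi_ge n m : (maxn n (M n) <= m)%N -> (n <= phi m)%N.
  rewrite geq_max => /andP[nm Mm].
  by apply: (@leq_bigmax_cond _ _ (fun i : 'I_m.+1 => i : nat) (Ordinal (nm : (n < m.+1)%N))).
(* From [M 0] on the range contains row 0, so the maximum is attained instead of being the default 0
   of an empty range. *)
have Mphi m : (M 0 <= m)%N -> (M (phi m) <= m)%N.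
  move=> M0; have [|i Mi phii] := @eq_bigmax_cond _ (fun n : 'I_m.+1 => (M n <= m)%N) val.
    by apply/card_gt0P; exists ord0.
  by rewrite /phi phii.
have phi_cvg : phi @ \oo --> \oo.
  move=> A [N _ NA]; exists (maxn N (M N)) => // m /= /phi_ge; exact: NA.
exists phi; split => //.
(* Borel-Cantelli: the measures are dominated by a series of sum at most 1. *)
have B0 : P (lim_sup_set B) = 0.
  apply: lim_sup_set_cvg0 => //; apply: le_lt_trans (ltry 1).
  apply: le_trans (epsilon_trick0 xpredT ler01).
  apply: lee_nneseries => [n _ _|n _]; first by [].
  exact: ltW (PB n).
exists (lim_sup_set B); split => //.
  by apply: bigcap_measurable => // k _; exact: bigcup_measurable.
move=> w; apply: contra_notP => /= Bw.
have {Bw} [N NB] : exists N, forall n, (N <= n)%N -> ~ B n w.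
  move/existsNP : Bw => [N /not_implyP[_ NB]]; exists N => n Nn Bn.
  by apply: NB; exists n.
have cphi : (fun m => c (phi m)) @ \oo --> l by exact: cvg_comp phi_cvg cl.
apply/cvgrPdist_lt => e e0.
have e20 : 0 < e / 2 by rewrite divr_gt0.
have [K _ Ke] : \forall n \near \oo, n.+1%:R^-1 < e / 2 :> R.
  exact: near_infty_natSinv_lt (PosNum e20).
near=> m.
rewrite [e]splitr -(subrK (c (phi m)) l) -addrA.
apply: (le_lt_trans (ler_normD _ _)); apply: ltrD.
  by near: m; move/cvgrPdist_lt : cphi; apply.
rewrite distrC; apply: lt_trans (Ke (phi m) _); last first.
  by near: m; apply: (phi_cvg [set n | (K <= n)%N]); exists K.
apply: BM.
  by apply: Mphi; near: m; exact: nbhs_infty_ge.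
by apply: NB; near: m; apply: (phi_cvg [set n | (N <= n)%N]); exists N.
Unshelve. all: by end_near. Qed.

End DiagonalSequence.

(** * Approximation of bounded functions by superlevel sets *)

Section LayerApproximation.
Context {R : realType}.

(** The sum counts the positive multiples of [e] up to [y], so [e] times it is [y] rounded down to a
    multiple of [e]. *)
Lemma layer_sum_bounds (e y : R) (N : nat) : 0 < e -> 0 <= y <= N%:R * e ->
  0 <= y - e * \sum_(i < N) (i.+1%:R * e <= y)%R%:R <= e.
Proof.
move=> e0; elim: N => [|N IHN] /andP[y0 yN].
  by rewrite big_ord0 mulr0 subr0 y0/=; move: yN; rewrite mul0r => /le_trans; apply; exact: ltW.
rewrite big_ord_recr/=; have [yNe|Ney] := leP y (N%:R * e).
  have -> : (N.+1%:R * e <= y) = false.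
    by apply/negbTE; rewrite -ltNge (le_lt_trans yNe)// ltr_pM2r// ltr_nat.
  by rewrite addr0 IHN// y0.
rewrite (eq_bigr (fun=> 1)) => [|i _]; last first.
  by rewrite (le_trans _ (ltW Ney))// ler_pM2r// ler_nat.
rewrite sumr_const card_ord; move: yN Ney; rewrite -natr1.
move: N%:R => n yN Ney; case: (leP ((n + 1) * e) y) => /= ?; apply/andP; split; nra.
Qed.

End LayerApproximation.

Section BoundedLayers.
Context {R : realType} {disp : measure_display} {S : measurableType disp}.
Variables (h : S -> R) (M : R).
Hypothesis mh : measurable_fun setT h.
Hypothesis hM : forall xi, 0 <= h xi <= M.

Definition layer (p i : nat) : set S := [set xi | i.+1%:R / p.+1%:R <= h xi].

(** A layer-cake sum: [h] rounded down to a multiple of 1/(p+1). [Num.bound] gives an integer above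
    [M * p.+1], so the layers reach [M]. *)
Definition layer_approx (p : nat) (xi : S) : R :=
  p.+1%:R^-1 * \sum_(i < Num.bound (M * p.+1%:R)) \1_(layer p i) xi.

Lemma measurable_layer p i : measurable (layer p i).
Proof.
rewrite (_ : layer p i = h @^-1` `[i.+1%:R / p.+1%:R, +oo[).
  by rewrite -[X in measurable X]setTI; exact: mh.
by apply/seteqP; split => xi /=; rewrite in_itv/= andbT.
Qed.

Lemma layer_approx_bounds p xi : 0 <= h xi - layer_approx p xi <= p.+1%:R^-1.
Proof.
have /andP[h0 hxiM] := hM xi.
rewrite /layer_approx (eq_bigr (fun i : 'I_ _ =>
    (i.+1%:R * p.+1%:R^-1 <= h xi)%R%:R)) => [|i _]; last first.
  by rewrite indicE; congr (_%:R); congr nat_of_bool; apply/idP/idP; rewrite inE.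
apply: layer_sum_bounds; rewrite ?invr_gt0// h0/= (le_trans hxiM)//.
rewrite ler_pdivlMr//; apply/ltW/archi_boundP.
by rewrite mulr_ge0// (le_trans h0).
Qed.

End BoundedLayers.

(** * Sums of a function over the points of a process *)

Section ProcessSums.
Context {R : realType} {disp : measure_display} {S : measurableMetricType disp R}.
Context {dT : measure_display} {T : measurableType dT}.

Lemma count_inE (X : T -> {fset S}) (A : set S) (w : T) :
  \sum_(xi <- X w) \1_A xi = (count_in X A w)%:R :> R.
Proof.
rewrite /count_in card_fset_sum1 -big_fset_condE/= natr_sum [RHS]big_mkcond/=.
by apply: eq_bigr => xi _; rewrite indicE; case: ifP.
Qed.

Lemma process_sum_layer_approx (h : S -> R) (M : R) p (X : T -> {fset S}) w :
  \sum_(xi <- X w) layer_approx h M p xi =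
  p.+1%:R^-1 * \sum_(i < Num.bound (M * p.+1%:R)) (count_in X (layer h p i) w)%:R.
Proof.
rewrite -mulr_sumr exchange_big/=; congr (_ * _).
by apply: eq_bigr => i _; rewrite count_inE.
Qed.

Lemma process_sum_bounds (f g : S -> R) (e : R) (X : T -> {fset S}) w :
  (forall xi, 0 <= f xi - g xi <= e) ->
  0 <= \sum_(xi <- X w) f xi - \sum_(xi <- X w) g xi <=
    e * (count_in X setT w)%:R.
Proof.
move=> fg; rewrite -sumrB sumr_ge0/= => [|xi _]; last by have /andP[] := fg xi.
rewrite -count_inE mulr_sumr; apply: ler_sum => xi _.
by rewrite indicT mulr1; have /andP[] := fg xi.
Qed.

(** The sum is the pointwise limit of combinations of counts of layers, the error being at most
    1/(p+1) times the finite number of points. *)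
Lemma measurable_process_sum (h : S -> R) (M : R) (X : T -> {fset S}) :
  measurable_fun setT h -> (forall xi, 0 <= h xi <= M) ->
  (forall A, measurable A -> measurable_fun setT (count_in X A)) ->
  measurable_fun setT (fun w => \sum_(xi <- X w) h xi).
Proof.
move=> mh hM mX.
apply: (@measurable_fun_cvg _ _ _ _
  (fun p w => \sum_(xi <- X w) layer_approx h M p xi)).
  move=> p; under eq_fun do rewrite process_sum_layer_approx.
  apply: measurable_funM => //; apply: measurable_sum => i.
  have mnat : measurable_fun setT (fun n : nat => n%:R : R) by [].
  by apply: (measurableT_comp mnat); apply: mX; exact: measurable_layer.
move=> w _; apply/cvgrPdist_le => e e0; near=> p.
have /andP[d0 d1] := process_sum_bounds X w (layer_approx_bounds hM p).
rewrite ger0_norm// (le_trans d1)// mulrC ler_pdivrMr// mulrC -ler_pdivrMr//.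
near: p; exists (Num.bound ((count_in X setT w)%:R / e)) => // p /= bp.
apply/ltW/(lt_le_trans (archi_boundP _)); first by rewrite divr_ge0// ltW.
by rewrite ler_nat (leq_trans bp).
Unshelve. all: by end_near. Qed.

End ProcessSums.

(** * Strong law for sums over independent Poisson processes *)

Section ProcessStrongLaw.
Context {R : realType} {disp : measure_display} {S : measurableMetricType disp R}.
Context {dT : measure_display} {T : measurableType dT}.
Variables (P : probability T R) (nu : {measure set S -> \bar R}) (lambda : S -> R).
Variable X : nat -> T -> {fset S}.
Hypothesis lambda_ge0 : forall xi, 0 <= lambda xi.
Hypothesis lambda_integrable : nu.-integrable [set: S] (EFin \o lambda).
Hypothesis X_poisson : forall j, poisson_process P nu lambda (X j).
Hypothesis X_independent :
  independent_classes P (fun j => sigma_process (X j)).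

(** The events of one count belong to the sigma-algebra of its process, so counts of [A] in
    different processes inherit independence. *)
Lemma count_strong_law (A : set S) : measurable A ->
  {ae P, forall w, (fun m => m%:R^-1 * \sum_(j < m) (count_in (X j) A w)%:R : R)
    @ \oo --> \int[nu]_(xi in A) lambda xi}.
Proof.
move=> mA; apply: (@poisson_strong_law _ _ _ P (fun j => count_in (X j) A)).
- by rewrite Rintegral_ge0.
- by move=> j; have [mX _ _] := X_poisson j; exact: mX.
- move=> J E JE; apply: X_independent => j jJ.
  have : (\bigcup_(B in measurable) sigma_of (count_in (X j) B)) (E j).
    by exists A => //; exact: JE.
  exact: sub_sigma_algebra.
- by move=> j B; have [_ _] := X_poisson j; exact.
Qed.

Let bounded_lambda_integrable (h : S -> R) (M : R) :
  measurable_fun setT h -> (forall xi, 0 <= h xi <= M) ->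
  nu.-integrable setT (EFin \o (fun xi => h xi * lambda xi)).
Proof.
move=> mh hM.
apply: (@integrableMr _ _ _ _ _ measurableT h (EFin \o lambda)) => //.
exists M; split; first exact: num_real.
move=> y My xi _; have /andP[h0 hxiM] := hM xi.
by rewrite /= ger0_norm// (le_trans hxiM)// ltW.
Qed.

Let indic_bounds (A : set S) xi : 0 <= (\1_A xi : R) <= 1.
Proof. by rewrite indicE; case: (xi \in A); rewrite ?lexx ?ler01. Qed.

Lemma Rintegral_indicM (A : set S) :
  \int[nu]_xi (\1_A xi * lambda xi) = \int[nu]_(xi in A) lambda xi.
Proof.
rewrite [RHS]Rintegral_mkcond; apply: eq_Rintegral => xi _.
by rewrite patch_indic mulrC.
Qed.

(** The integral counterpart of [process_sum_layer_approx], each count replaced by its mean.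
    Integrability is proved along with the value, since additivity of the integral requires it at
    each layer. *)
Lemma Rintegral_layer_approx (h : S -> R) (M : R) p :
  measurable_fun setT h ->
  nu.-integrable setT (EFin \o (fun xi => layer_approx h M p xi * lambda xi)) /\
  \int[nu]_xi (layer_approx h M p xi * lambda xi) =
  p.+1%:R^-1 * \sum_(i < Num.bound (M * p.+1%:R))
    \int[nu]_(xi in layer h p i) lambda xi.
Proof.
move=> mh; pose s n xi := \sum_(i < n) (\1_(layer h p i) xi * lambda xi).
have iA i : nu.-integrable setT
    (EFin \o (fun xi => \1_(layer h p i) xi * lambda xi)).
  apply: bounded_lambda_integrable => //.
  by apply: measurable_indic; exact: measurable_layer.
have [is_ ss] : nu.-integrable setT (EFin \o s (Num.bound (M * p.+1%:R))) /\
    \int[nu]_xi s (Num.bound (M * p.+1%:R)) xi =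
    \sum_(i < Num.bound (M * p.+1%:R)) \int[nu]_(xi in layer h p i) lambda xi.
  elim: Num.bound => [|n [isn IHn]].
    rewrite big_ord0 (_ : s 0%N = cst 0); last by apply/funext => xi; rewrite /s big_ord0.
    by split; [exact: integrable0|rewrite Rintegral_cst// mul0r].
  have sS : s n.+1 = fun xi => s n xi + \1_(layer h p n) xi * lambda xi.
    by apply/funext => xi; rewrite /s big_ord_recr.
  rewrite sS big_ord_recr/= -IHn -Rintegral_indicM RintegralD//; split => //.
  exact: (integrableD measurableT isn (iA n)).
have lE : (fun xi => layer_approx h M p xi * lambda xi) =
    (fun xi => p.+1%:R^-1 * s (Num.bound (M * p.+1%:R)) xi).
  by apply/funext => xi; rewrite /layer_approx -mulrA mulr_suml.
rewrite lE RintegralZl// ss; split => //.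
exact: (integrableZl measurableT _ is_).
Qed.

(** [h] is replaced by a layer approximation [g], whose sums are finite combinations of counts; the
    empirical cost is controlled by the law for the total count. *)
Lemma process_strong_law (h : S -> R) (M : R) :
  measurable_fun setT h -> (forall xi, 0 <= h xi <= M) ->
  {ae P, forall w, (fun m => m%:R^-1 * \sum_(j < m) \sum_(xi <- X j w) h xi)
    @ \oo --> \int[nu]_xi (h xi * lambda xi)}.
Proof.
move=> mh hM; set mu := \int[nu]_xi lambda xi.
have mu0 : 0 <= mu by apply: Rintegral_ge0 => xi _; exact: lambda_ge0.
(* All layers of all precisions share one null set, since [p] is chosen only later, from [e]. *)
have : {ae P, forall w, forall p i,
    (fun m => m%:R^-1 * \sum_(j < m) (count_in (X j) (layer h p i) w)%:R : R)
      @ \oo --> \int[nu]_(xi in layer h p i) lambda xi}.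
  apply: ae_foralln => p; apply: ae_foralln => i.
  by apply: count_strong_law; exact: measurable_layer.
have := count_strong_law measurableT; rewrite -/mu.
apply: filterS2 => w wT wlayer; apply/cvgrPdist_lt => e e0.
pose a f m : R := m%:R^-1 * \sum_(j < m) \sum_(xi <- X j w) f xi.
(* Three errors add up to this: [q] for the limit of [a g], [q * (mu + 1)] between the empirical
   means of [h] and [g], [q * mu] between their integrals. *)
have [p pe] : exists p, (2 * mu + 2) / p.+1%:R < e.
  exists (Num.bound ((2 * mu + 2) / e)).
  rewrite ltr_pdivrMr// -ltr_pdivrMl// mulrC.
  apply: lt_trans (archi_boundP _) _; last by rewrite ltr_nat.
  by rewrite divr_ge0 ?addr_ge0 ?mulr_ge0// ltW.
pose g := layer_approx h M p; pose q : R := p.+1%:R^-1.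
have q0 : 0 < q by rewrite invr_gt0.
have [ig Ig] := Rintegral_layer_approx M p mh.
have ih := bounded_lambda_integrable mh hM.
have ag : a g @ \oo --> \int[nu]_xi (g xi * lambda xi).
  rewrite Ig (_ : a g = fun m => p.+1%:R^-1 * \sum_(i < Num.bound (M * p.+1%:R))
      (m%:R^-1 * \sum_(j < m) (count_in (X j) (layer h p i) w)%:R)).
    apply: cvgM; first exact: cvg_cst.
    by apply: cvg_big => [|i _]; [exact: add_continuous|exact: wlayer].
  apply/funext => m; rewrite /a.
  under eq_bigr do rewrite process_sum_layer_approx.
  by rewrite -mulr_sumr exchange_big/= mulrCA -!mulr_sumr.
have Igh : 0 <= \int[nu]_xi (h xi * lambda xi) - \int[nu]_xi (g xi * lambda xi)
    <= q * mu.
  rewrite -RintegralB//; apply/andP; split.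
    apply: Rintegral_ge0 => xi _; rewrite -mulrBl mulr_ge0//.
    by have /andP[] := layer_approx_bounds hM p xi.
  rewrite -RintegralZl//; apply: le_Rintegral => //.
  - exact: (integrableB measurableT ih ig).
  - exact: (integrableZl measurableT q lambda_integrable).
  - move=> xi _; rewrite -mulrBl ler_wpM2r//.
    by have /andP[] := layer_approx_bounds hM p xi.
near=> m.
have agm : `|\int[nu]_xi (g xi * lambda xi) - a g m| < q.
  by near: m; move/cvgrPdist_lt : ag; apply.
have am : `|mu - m%:R^-1 * \sum_(j < m) (count_in (X j) setT w)%:R| < 1.
  by near: m; move/cvgrPdist_lt : wT; apply.
have agh : 0 <= a h m - a g m <=
    q * (m%:R^-1 * \sum_(j < m) (count_in (X j) setT w)%:R).
  rewrite [q * _]mulrCA mulr_sumr /a -mulrBr -sumrB; apply/andP; split.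
    rewrite mulr_ge0// sumr_ge0// => j _.
    by have /andP[] := process_sum_bounds (X j) w (layer_approx_bounds hM p).
  rewrite ler_wpM2l// ler_sum// => j _.
  by have /andP[] := process_sum_bounds (X j) w (layer_approx_bounds hM p).
move: pe; rewrite -/q -/(a h m) => pe.
move: am agm agh Igh; move: (a h m) (a g m) (m%:R^-1 * _) => ah ag' am.
move: (Rintegral _ _ _) (Rintegral _ _ _) => Ih Ig'.
rewrite !ltr_norml => /andP[? ?] /andP[? ?] /andP[? ?] /andP[? ?].
have : q * am <= q * (mu + 1) by rewrite ler_pM2l//; lra.
by move=> ?; apply/andP; split; nra.
Unshelve. all: by end_near. Qed.

End ProcessStrongLaw.

(** * Diameter, Borel sets and the support of a measure *)

Section CompactMetricSpace.
Context {R : realType} {disp : measure_display} {S : measurableMetricType disp R}.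

Lemma mdist_continuous (x : S) : continuous (mdist x : S -> R).
Proof.
move=> y; apply/cvgrPdist_lt => e e0.
apply: filterS (nbhsx_ballx y e e0) => z; rewrite ballEmdist/= => yz.
apply: le_lt_trans yz; rewrite ler_norml; apply/andP; split.
  by have := metric_triangle x y z; lra.
by have := metric_triangle x z y; rewrite (metric_sym z y); lra.
Qed.

(** The supremum bounds the distances once they are bounded: compactness gives a point [c] farthest
    from [x], and twice [mdist x c] is a bound. *)
Lemma mdist_le_diam : compact [set: S] -> forall x y : S, mdist x y <= diam S.
Proof.
move=> cS x y.
have [c _ cmax] : exists2 c : S, c \in setT &
    forall t, t \in setT -> (mdist x t : R) <= mdist x c.
  apply: compact_EVT_max => //; first by exists x.
  by apply: continuous_subspaceT; exact: mdist_continuous.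
apply: ub_le_sup; last by exists (x, y).
exists (mdist x c + mdist x c) => _ [[u v] _ <-]/=.
apply: (le_trans (metric_triangle u x v)).
by rewrite (metric_sym u x) lerD// cmax// inE.
Qed.

Section Borel.
Hypothesis S_borel : borel_measurable S.

Lemma open_borel_measurable (U : set S) : open U -> measurable U.
Proof. by move=> oU; rewrite S_borel; exact: sub_sigma_algebra. Qed.

Lemma continuous_borel_measurable_fun (f : S -> R) :
  continuous f -> measurable_fun setT f.
Proof.
move=> /continuousP cf; apply: (measurability _ (RGenOpens.measurableE R)).
move=> _ [_ [a [b ->] <-]]; rewrite setTI.
by apply/open_borel_measurable/cf/interval_open.
Qed.

Lemma measurable_mball (x : S) (e : R) : measurable (ball x e).
Proof.
rewrite ballEmdist (_ : [set y | _] = mdist x @^-1` `]-oo, e[).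
  rewrite -[X in measurable X]setTI.
  by apply: continuous_borel_measurable_fun => //; exact: mdist_continuous.
by apply/seteqP; split => y /=; rewrite in_itv.
Qed.

(** A point outside the support has a null ball around it, hence lies in a null ball with centre in
    [D] and radius 1/(m+1); these are countably many. *)
Lemma ae_in_support (nu : {measure set S -> \bar R}) : separable S ->
  {ae nu, forall x : S, forall e : R, 0 < e -> (0 < nu (ball x e))%E}.
Proof.
move=> [D [/countable_injP[f finj] dD]].
pose r m : R := m.+1%:R^-1.
(* [f] numbers the points of [D] injectively, so [N m n] has at most one centre: it is a null ball
   or empty. *)
pose N m n := \bigcup_(x in [set x | [/\ D x, f x = n & nu (ball x (r m)) = 0]])
  ball x (r m).
have N0 m n : nu.-negligible (N m n).
  have [[x [Dx fx x0]]|noN] := pselect (exists x,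
      [/\ D x, f x = n & nu (ball x (r m)) = 0]).
    exists (ball x (r m)); split => //; first exact: measurable_mball.
    move=> y [x' [Dx' fx' _] x'y].
    by rewrite (finj x x') ?inE ?fx ?fx'.
  rewrite (_ : N m n = set0); first exact: negligible_set0.
  by rewrite -subset0 => y [x Dx _]; apply: noN; exists x.
have : nu.-negligible (\bigcup_m \bigcup_n N m n).
  by apply: negligible_bigcup => m; exact: negligible_bigcup.
apply: negligibleS => x /= /existsNP[e /not_implyP[e0 /negP]].
rewrite -leNgt measure_le0 => /eqP nue0.
have [m rm] : exists m, r m < e / 2.
  have e20 : 0 < e / 2 by rewrite divr_gt0.
  have [m _ me] : \forall n \near \oo, n.+1%:R^-1 < e / 2 :> R.
    exact: near_infty_natSinv_lt (PosNum e20).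
  by exists m; exact: me (leqnn m).
have [y [xy Dy]] : ball x (r m) `&` D !=set0.
  apply: dD; first by exists x; apply: ballxx; rewrite invr_gt0.
  rewrite ballEmdist (_ : [set y | _] = mdist x @^-1` `]-oo, r m[).
    by move/continuousP: (@mdist_continuous x); apply; exact: interval_open.
  by apply/seteqP; split => z /=; rewrite in_itv.
exists m => //; exists (f y) => //; exists y; last exact: ball_sym.
split => //; apply: subset_measure0 nue0 => //; try exact: measurable_mball.
move=> z yz; apply: (@le_ball _ _ x (r m + r m)); last exact: ball_triangle xy yz.
by lra.
Qed.

End Borel.
End CompactMetricSpace.

(** * Finiteness of the base measure *)

Section FiniteBase.
Context {R : realType} {disp : measure_display} {S : measurableMetricType disp R}.

(** By compactness [lambda] has a positive minimum, so an infinite total mass would make its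
    integral infinite. Finiteness of [nu] makes bounded kernels integrable. *)
Lemma integrable_pos_continuous_finite (nu : {measure set S -> \bar R})
    (lambda : S -> R) :
  compact [set: S] -> nu.-integrable setT (EFin \o lambda) ->
  continuous lambda -> (forall x, 0 < lambda x) -> (nu setT < +oo)%E.
Proof.
move=> cS /integrableP[ml il] cl l0.
have [c _ cmin] : exists2 c : S, c \in setT & forall t, t \in setT -> lambda c <= lambda t.
  apply: compact_EVT_min => //; first by exists point.
  exact: continuous_subspaceT.
rewrite ltNge leye_eq; apply/negP => /eqP nuT; move: il; rewrite ltNge => /negP; apply.
apply: (@le_trans _ _ (\int[nu]_(x in setT) (lambda c)%:E)%E).
  by rewrite integral_cst// nuT gt0_muley ?lte_fin.
apply: ge0_le_integral => //.
- by move=> x _; rewrite lee_fin ltW.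
- by apply: measurableT_comp.
- by move=> x _; rewrite /= lee_fin gtr0_norm//; apply: cmin; rewrite inE.
Qed.

End FiniteBase.

(** * The kernel, its mass and the bias after normalization *)

Section Kernel.
Context {R : realType} {disp : measure_display} {S : measurableMetricType disp R}.
Variables (nu : {measure set S -> \bar R}) (k : R -> R) (d : R).
Hypothesis S_borel : borel_measurable S.
Hypothesis S_compact : compact [set: S].
Hypothesis nu_finite : (nu setT < +oo)%E.
Hypothesis k_ge0 : forall t, 0 <= k t.
Hypothesis k_supp : forall t, diam S < `|t| -> k t = 0.
Hypothesis k_continuous : {within `[0, diam S], continuous k}.
Hypothesis k_lower : exists k0 : R,
  0 < k0 /\ forall t, 0 <= t <= diam S -> k0 < k t.

Let diam_ge0 : 0 <= diam S.
Proof. exact: le_trans (mdist_ge0 point point) (mdist_le_diam S_compact _ _). Qed.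

Lemma kernel_bounded : exists M, forall t, 0 <= t -> k t <= M.
Proof.
have [c _ cmax] : exists2 c, c \in `[0, diam S]%classic &
    forall t, t \in `[0, diam S]%classic -> k t <= k c.
  apply: compact_EVT_max => //; last exact: segment_compact.
  by exists 0; rewrite /= in_itv/= lexx.
exists (k c) => t t0; have [td|dt] := leP t (diam S).
  by apply: cmax; rewrite inE/= in_itv/= t0.
by rewrite k_supp// ger0_norm.
Qed.

(** At nonnegative arguments [k] agrees with its restriction to [0, diam S] extended by zero, which
    is measurable by continuity on that segment. *)
Lemma measurable_scaled_kernel (s : R) (zeta : S) : 0 < s ->
  measurable_fun setT (scaled_kernel k d s zeta).
Proof.
move=> s0; apply: measurable_funM => //.
have mk : measurable_fun setT (k \_ `[0, diam S]).
  have mI : measurable (`[0, diam S] : set R) by exact: measurable_itv.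
  apply: (measurable_restrictT k mI).1.
  exact: (subspace_continuous_measurable_fun mI k_continuous).
rewrite (_ : (fun _ => _) = (k \_ `[0, diam S]) \o (fun xi => mdist zeta xi / s)).
  apply: measurableT_comp => //; apply: measurable_funM => //.
  by apply: continuous_borel_measurable_fun => //; exact: mdist_continuous.
apply/funext => xi /=; rewrite patchE; case: ifPn => //.
have xi0 : 0 <= mdist zeta xi / s by rewrite divr_ge0 ?mdist_ge0// ltW.
rewrite notin_setE/= in_itv/= xi0/= => /negP.
by rewrite -ltNge => ?; rewrite k_supp// ger0_norm.
Qed.

Lemma scaled_kernel_ge0 (s : R) (zeta xi : S) : 0 <= scaled_kernel k d s zeta xi.
Proof. by rewrite mulr_ge0// invr_ge0 powR_ge0. Qed.

Lemma scaled_kernel_bounded (s : R) (zeta : S) : 0 < s ->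
  exists M, forall xi, 0 <= scaled_kernel k d s zeta xi <= M.
Proof.
move=> s0; have [M kM] := kernel_bounded; exists ((s `^ d)^-1 * M) => xi.
rewrite scaled_kernel_ge0/= ler_wpM2l ?invr_ge0 ?powR_ge0//.
by rewrite kM// divr_ge0 ?mdist_ge0// ltW.
Qed.

Lemma integrable_ge0_bounded (f : S -> R) : measurable_fun setT f ->
  (exists M, forall xi, 0 <= f xi <= M) -> nu.-integrable setT (EFin \o f).
Proof.
move=> mf [M fM]; apply: measurable_bounded_integrable => //.
exists M; split; first exact: num_real.
move=> y My xi _; have /andP[f0 fxiM] := fM xi.
by rewrite /= ger0_norm// (le_trans fxiM)// ltW.
Qed.

(** On a small ball around [zeta] the argument of [k] stays in [0, diam S], so the kernel is at
    least [c] there, and the ball has positive measure. *)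
Lemma kernel_mass_gt0 (s : R) (zeta : S) : 0 < s ->
  (forall e : R, 0 < e -> (0 < nu (ball zeta e))%E) ->
  0 < kernel_mass nu k d s zeta.
Proof.
move=> s0 zeta_supp; have [k0 [k00 k0k]] := k_lower.
pose c := (s `^ d)^-1 * k0.
have c0 : 0 < c by rewrite mulr_gt0// invr_gt0 powR_gt0.
(* A radius of 1 works when [diam S = 0], S being then a point. *)
have [e e0 eball] : exists2 e : R, 0 < e &
    forall xi, ball zeta e xi -> mdist zeta xi <= diam S * s.
  have [dS|dS] := ltP 0 (diam S).
    exists (diam S * s); first exact: mulr_gt0.
    by move=> xi; rewrite ballEmdist/= => /ltW.
  exists 1 => // xi _; rewrite (le_trans (mdist_le_diam S_compact _ _))//.
  by rewrite (le_trans dS)// mulr_ge0// ltW.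
have mB := measurable_mball S_borel zeta e.
have nuBfin : (nu (ball zeta e) < +oo)%E.
  by apply: le_lt_trans nu_finite; rewrite le_measure ?inE.
apply: (@lt_le_trans _ _ (c * fine (nu (ball zeta e)))).
  by rewrite mulr_gt0// fine_gt0// zeta_supp.
rewrite -Rintegral_cst// Rintegral_mkcond; apply: le_Rintegral => //.
- apply: integrable_ge0_bounded; first exact: (measurable_restrictT _ mB).1 (measurable_cst c).
  exists c => xi; rewrite patchE; case: ifP; rewrite ?lexx ?(ltW c0)//.
- apply: integrable_ge0_bounded; first exact: measurable_scaled_kernel.
  exact: scaled_kernel_bounded.
move=> xi _; rewrite patchE; case: ifPn => [|_]; last exact: scaled_kernel_ge0.
rewrite inE => /eball xis; rewrite ler_wpM2l ?invr_ge0 ?powR_ge0//.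
apply/ltW/k0k; rewrite ler_pdivrMr// xis andbT.
by rewrite divr_ge0 ?mdist_ge0// ltW.
Qed.

(** A probability density with respect to [nu] when the mass is positive. *)
Definition normalized_kernel (s : R) (zeta xi : S) : R :=
  (kernel_mass nu k d s zeta)^-1 * scaled_kernel k d s zeta xi.

Section NormalizedKernel.
Variables (zeta : S) (s : R).
Hypothesis s_gt0 : 0 < s.
Hypothesis mass_gt0 : 0 < kernel_mass nu k d s zeta.

Let mass_inv_ge0 : 0 <= (kernel_mass nu k d s zeta)^-1.
Proof. by rewrite invr_ge0 ltW. Qed.

Lemma measurable_normalized_kernel :
  measurable_fun setT (normalized_kernel s zeta).
Proof. by apply: measurable_funM => //; exact: measurable_scaled_kernel. Qed.

Lemma normalized_kernel_bounded :
  exists M, forall xi, 0 <= normalized_kernel s zeta xi <= M.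
Proof.
have [M kM] := scaled_kernel_bounded zeta s_gt0.
exists ((kernel_mass nu k d s zeta)^-1 * M) => xi.
by have /andP[k0 kxiM] := kM xi; rewrite mulr_ge0//= ler_wpM2l.
Qed.

Lemma Rintegral_normalized_kernel : \int[nu]_xi normalized_kernel s zeta xi = 1.
Proof.
rewrite RintegralZl//; first by rewrite mulVf// gt_eqF.
apply: integrable_ge0_bounded; first exact: measurable_scaled_kernel.
exact: scaled_kernel_bounded.
Qed.

Lemma normalized_kernel_out (xi : S) :
  diam S * s < mdist zeta xi -> normalized_kernel s zeta xi = 0.
Proof.
move=> dxi; rewrite /normalized_kernel /scaled_kernel k_supp ?mulr0//.
by rewrite ger0_norm ?divr_ge0 ?mdist_ge0 ?(ltW s_gt0)// ltr_pdivlMr.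
Qed.

(** The density has integral 1, so [lambda zeta] is the average of a constant and the difference
    goes under the integral; beyond distance [diam S * s] the density vanishes. *)
Lemma normalized_kernel_bias (lambda : S -> R) (e : R) :
  nu.-integrable setT (EFin \o lambda) ->
  (forall xi, mdist zeta xi <= diam S * s -> `|lambda xi - lambda zeta| <= e) ->
  `|\int[nu]_xi (normalized_kernel s zeta xi * lambda xi) - lambda zeta| <= e.
Proof.
move=> ilambda lambda_near.
have ik : nu.-integrable setT (EFin \o normalized_kernel s zeta).
  apply: integrable_ge0_bounded; first exact: measurable_normalized_kernel.
  exact: normalized_kernel_bounded.
have [M kM] := normalized_kernel_bounded.
have k0 xi : 0 <= normalized_kernel s zeta xi by have /andP[] := kM xi.
have ikl : nu.-integrable setT
    (EFin \o (fun xi => normalized_kernel s zeta xi * lambda xi)).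
  apply: (@integrableMr _ _ _ _ _ measurableT (normalized_kernel s zeta)
    (EFin \o lambda)) => //; first exact: measurable_normalized_kernel.
  exists M; split; first exact: num_real.
  move=> y My xi _; rewrite /= ger0_norm//.
  by have /andP[_ kxiM] := kM xi; rewrite (le_trans kxiM)// ltW.
have ikz : nu.-integrable setT
    (EFin \o (fun xi => normalized_kernel s zeta xi * lambda zeta)).
  exact: (integrableZr measurableT (lambda zeta) ik).
have -> : lambda zeta = \int[nu]_xi (normalized_kernel s zeta xi * lambda zeta).
  by rewrite RintegralZr// Rintegral_normalized_kernel mul1r.
rewrite -RintegralB//.
have iklz := integrableB measurableT ikl ikz.
apply: (le_trans (le_normr_Rintegral measurableT iklz)).
rewrite -[leRHS]mul1r -Rintegral_normalized_kernel -RintegralZr//.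
apply: le_Rintegral => //.
- exact: (integrable_norm iklz).
- exact: (integrableZr measurableT e ik).
move=> xi _; rewrite -mulrBr normrM (ger0_norm (k0 _)).
have [near|far] := leP (mdist zeta xi) (diam S * s).
  by rewrite ler_wpM2l// lambda_near.
by rewrite normalized_kernel_out// !mul0r.
Qed.

End NormalizedKernel.

Lemma lambda_hathatE (s : R) (x : nat -> {fset S}) (m : nat) (zeta : S) :
  lambda_hathat nu k d s x m zeta =
  m%:R^-1 * \sum_(j < m) \sum_(xi <- x j) normalized_kernel s zeta xi.
Proof. by congr (_ * _); apply: eq_bigr => j _; rewrite -mulr_sumr. Qed.

End Kernel.

(** * Almost sure convergence at points of the support of [nu] *)

Theorem theorem1 (R : realType) (disp : measure_display)
    (S : measurableMetricType disp R)
    (S_borel : borel_measurable S)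
    (S_separable : separable S)
    (S_compact : compact [set: S])
    (nu : {measure set S -> \bar R})
    (lambda : S -> R)
    (lambda_ge0 : forall zeta, 0 <= lambda zeta)
    (lambda_integrable : nu.-integrable [set: S] (EFin \o lambda))
    (lambda_continuous : continuous lambda)
    (lambda_pos : forall zeta, exists lambda0 : R,
       0 < lambda0 /\ lambda0 <= lambda zeta)
    (k : R -> R)
    (k_ge0 : forall t, 0 <= k t)
    (k_sym : forall t, k (- t) = k t)
    (k_supp : forall t, diam S < `|t| -> k t = 0)
    (k_continuous : {within `[0, diam S], continuous k})
    (k_lower : exists k0 : R,
       0 < k0 /\ forall t, 0 <= t <= diam S -> k0 < k t)
    (d : R) (d_gt0 : 0 < d)
    (dT : measure_display) (Omega : measurableType dT)
    (P : probability Omega R)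
    (X : nat -> Omega -> {fset S})
    (X_poisson : forall j, poisson_process P nu lambda (X j))
    (X_independent : independent_classes P (fun j => sigma_process (X j))) :
  {ae nu, forall zeta : S, exists sigma : nat -> R,
    [/\ forall m, 0 < sigma m,
        sigma @ \oo --> (0 : R)
      & {ae P, forall w : Omega,
          (fun m : nat =>
             `|lambda_hathat nu k d (sigma m) (fun j => X j w) m zeta
               - lambda zeta|) @ \oo --> (0 : R)}]}.
Proof.
have nu_finite : (nu setT < +oo)%E.
  apply: integrable_pos_continuous_finite lambda_continuous _ => // x.
  by have [l0 [l00 l0x]] := lambda_pos x; exact: lt_le_trans l0x.
apply: filterS (ae_in_support S_borel nu S_separable) => zeta zeta_supp.
(* Candidate smoothing parameters; the diagonal argument decides how slowly they are run through. *)
pose s n : R := n.+1%:R^-1.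
have s0 n : 0 < s n by rewrite invr_gt0.
have mass n := kernel_mass_gt0 d S_borel S_compact nu_finite k_ge0 k_supp
  k_continuous k_lower (s0 n) zeta_supp.
pose h n := normalized_kernel nu k d (s n) zeta.
have mh n : measurable_fun setT (h n) by exact: measurable_normalized_kernel.
have /choice[M hM] n : exists M, forall xi, 0 <= h n xi <= M.
  exact: normalized_kernel_bounded.
pose Z n m w : R := m%:R^-1 * \sum_(j < m) \sum_(xi <- X j w) h n xi.
have mZ n m : measurable_fun setT (Z n m).
  apply: measurable_funM => //; apply: measurable_sum => j.
  apply: (measurable_process_sum (mh n) (hM n)) => A mA.
  by have [mX _ _] := X_poisson j; exact: mX.
have Zcvg n := process_strong_law lambda_ge0 lambda_integrable X_poisson
  X_independent (mh n) (hM n).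
(* [h n] vanishes at distances above [diam S * s n] from [zeta]; this radius tends to 0, so
   continuity of [lambda] at [zeta] controls the bias. *)
have bias : (fun n => \int[nu]_xi (h n xi * lambda xi)) @ \oo --> lambda zeta.
  apply/cvgrPdist_le => e e0.
  have : \forall xi \near zeta, `|lambda zeta - lambda xi| <= e.
    by move/cvgrPdist_le : (lambda_continuous zeta); apply.
  move=> /nbhs_ballP[r /= r0 rball].
  have : (fun n => diam S * s n) @ \oo --> (0 : R).
    rewrite -[X in _ --> X](mulr0 (diam S)).
    by apply: cvgM; [exact: cvg_cst|exact: cvg_harmonic].
  move=> /cvgrPdist_lt /(_ r r0); apply: filterS => n; rewrite sub0r normrN => dr.
  rewrite distrC; apply: normalized_kernel_bias => // xi xis.
  rewrite distrC; apply: rball; rewrite ballEmdist/=.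
  by apply: le_lt_trans dr; apply: le_trans xis _; exact: ler_norm.
(* Rows of [Z] are smoothing levels, columns are numbers of processes. *)
have [phi [phioo Zphi]] := diagonal_ae_cvg mZ Zcvg bias.
exists (s \o phi); split => [m||].
- exact: s0.
- exact: cvg_comp phioo cvg_harmonic.
apply: filterS Zphi => w Zw.
under eq_fun do rewrite lambda_hathatE.
have : (fun m => `|Z (phi m) m w - lambda zeta|) @ \oo --> `|lambda zeta - lambda zeta|.
  by apply: cvg_norm; apply: cvgB => //; exact: cvg_cst.
by rewrite subrr normr0.
Qed.
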